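(* Let $\mathbb A$ be a distributive monoidal category. For any cell $\alpha:(U;A;B;W)$ of the free cornering with choice $\ulcorner\mathbb A\urcorner^{\oplus}$ and any object $C$ of $\mathbb A$, $$\frac{\alpha\mid\chi_{W,C}}{\sigma_{B,C}}=\frac{\sigma_{A,C}}{\chi_{U,C}\mid\alpha}$$ as cells $(U;A\otimes C;C\otimes B;W)$, where $\chi$ denotes the crossing cells of $\ulcorner\mathbb A\urcorner^{\oplus}$.
   Context: Monoidal categories are strict, and composites are in diagrammatic order ($fg$ is first $f$, then $g$). $\sigma_{A,B}:A\otimes B\to B\otimes A$ is the braiding, also denoting the cell $\ulcorner\sigma_{A,B}\urcorner$. A single-object double category $\mathbb D$ has a horizontal edge monoid $(\mathbb D_H,\otimes,I)$, a vertical edge monoid $(\mathbb D_V,\otimes,I)$, and for $A,B\in\mathbb D_H$, $U,W\in\mathbb D_V$ a set of cells $(U;A;B;W)$ (left; top; bottom; right boundary). For $\alpha:(U;A;B;V)$ and $\beta:(V;A';B';W)$ there is a horizontal composite $\alpha\mid\beta:(U;A\otimes A';B\otimes B';W)$; for $\alpha:(U;A;C;W)$ and $\beta:(U';C;B;W')$ a vertical composite $\frac{\alpha}{\beta}:(U\otimes U';A;B;W\otimes W')$. Both are associative and unital, with horizontal units $id_U:(U;I;I;U)$ and vertical units $1_A:(I;A;A;I)$, where $id_I=1_I$, $1_{A\otimes B}=1_A\mid 1_B$, $id_{U\otimes W}=\frac{id_U}{id_W}$, and interchange $\frac{\alpha}{\beta}\mid\frac{\gamma}{\delta}=\frac{\alpha\mid\gamma}{\beta\mid\delta}$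 holds. A distributive monoidal category $(\mathbb A,\otimes,\oplus,I)$ is a symmetric monoidal category with binary coproducts $A\oplus B$ (injections $\sigma_0,\sigma_1$, copairing $[f,g]$; no initial object required) such that $[\sigma_0\otimes 1_C,\sigma_1\otimes 1_C]:(A\otimes C)\oplus(B\otimes C)\to(A\oplus B)\otimes C$ is invertible for all $A,B,C$. Exchanges with choice: $\mathbb A^{\circ\bullet}_\oplus$ is the monoid (operation $\otimes$, unit $I$) with elements generated by $A^\circ$, $A^\bullet$ ($A\in\mathbb A_0$), $I$, $U\otimes W$, $U\times W$, $U+W$, subject only to associativity and unitality of $\otimes$. Free cornering with choice: $\ulcorner\mathbb A\urcorner^{\oplus}$ is the free single-object double category with horizontal edge monoid $(\mathbb A_0,\otimes,I)$, vertical edge monoid $\mathbb A^{\circ\bullet}_\oplus$, and generating cells and equations: (1) for each $f:A\to B$ in $\mathbb A$ a cell $\ulcorner f\urcorner:(I;A;B;I)$ (also written $f$), with $\ulcorner fg\urcorner=\frac{\ulcorner f\urcorner}{\ulcorner g\urcorner}$, $\ulcorner 1_A\urcorner=1_A$, $\ulcorner f\otimes g\urcorner=\ulcorner f\urcorner\mid\ulcorner g\urcorner$; (2) for each $A\in\mathbb A_0$ corner cells $\mathsf{get}_L^A:(A^\circ;I;A;I)$, $\mathsf{put}_R^A:(I;A;I;A^\circ)$, $\mathsf{get}_R^A:(I;I;A;A^\bullet)$, $\mathsf{put}_L^A:(A^\bullet;A;I;I)$ with $\mathsf{put}_R^A\mid\mathsf{get}_L^A=1_A$, $\frac{\mathsf{get}_L^A}{\mathsf{put}_R^A}=id_{A^\circ}$,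 $\mathsf{get}_R^A\mid\mathsf{put}_L^A=1_A$, $\frac{\mathsf{get}_R^A}{\mathsf{put}_L^A}=id_{A^\bullet}$; (3) for all $U,W$, cells $\pi_0:(U\times W;I;I;U)$, $\pi_1:(U\times W;I;I;W)$, and for $\alpha:(V;A;B;U)$, $\beta:(V;A;B;W)$ a unique cell $\alpha\times\beta:(V;A;B;U\times W)$ with $(\alpha\times\beta)\mid\pi_0=\alpha$, $(\alpha\times\beta)\mid\pi_1=\beta$; (4) for all $U,W$, cells $\iota_0:(U;I;I;U+W)$, $\iota_1:(W;I;I;U+W)$, and for $\alpha:(U;A;B;V)$, $\beta:(W;A;B;V)$ a unique cell $\alpha+\beta:(U+W;A;B;V)$ with $\iota_0\mid(\alpha+\beta)=\alpha$, $\iota_1\mid(\alpha+\beta)=\beta$; (5) for $\alpha:(U;A;C;W)$, $\beta:(U;B;C;W)$ a unique cell $[\alpha,\beta]:(U;A\oplus B;C;W)$ with $\frac{\ulcorner\sigma_0\urcorner}{[\alpha,\beta]}=\alpha$, $\frac{\ulcorner\sigma_1\urcorner}{[\alpha,\beta]}=\beta$. Crossing cells $\chi_{U,B}:(U;B;B;U)$, by induction on $U$: $\chi_{A^\circ,B}$ is the vertical composite (top to bottom) of $\mathsf{get}_L^A\mid 1_B$, $\sigma_{A,B}$, $1_B\mid\mathsf{put}_R^A$; $\chi_{A^\bullet,B}$ is the vertical composite (top to bottom) of $1_B\mid\mathsf{get}_R^A$, $\sigma_{B,A}$, $\mathsf{put}_L^A\mid 1_B$; $\chi_{I,B}=1_B$;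 $\chi_{U\otimes W,B}=\frac{\chi_{U,B}}{\chi_{W,B}}$; $\chi_{U+W,B}=(\chi_{U,B}\mid\iota_0)+(\chi_{W,B}\mid\iota_1)$; $\chi_{U\times W,B}=(\pi_0\mid\chi_{U,B})\times(\pi_1\mid\chi_{W,B})$. *)

(* Defs.v *)
From Stdlib Require Import List.
Import ListNotations.

Set Implicit Arguments.
Unset Strict Implicit.
Unset Printing Implicit Defensive.

(* Composition, here and for cells, is written in diagrammatic order. *)

Record Category := {
  ob :> Type;
  hom : ob -> ob -> Type;
  idm : forall A, hom A A;
  comp : forall A B C, hom A B -> hom B C -> hom A C;
  comp_idl : forall A B (f : hom A B), comp (idm A) f = f;
  comp_idr : forall A B (f : hom A B), comp f (idm B) = f;
  comp_assoc : forall A B C D (f : hom A B) (g : hom B C) (h : hom C D),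
    comp f (comp g h) = comp (comp f g) h }.

Arguments hom {c}.
Arguments idm {c} A.
Arguments comp {c A B C} f g.

(* The identity of [A], with its codomain transported along an equality of
   objects; strictness of the tensor on morphisms is expressed with it. *)
Definition idto (K : Category) (A B : K) (e : A = B) : hom A B :=
  match e in _ = B' return hom A B' with eq_refl => idm A end.

(* Strict: the associators and unitors are the morphisms [idto]. *)
Record StrictMonoidalCategory := {
  mon_cat :> Category;
  I : mon_cat;
  tens : mon_cat -> mon_cat -> mon_cat;
  tensm : forall A B A' B' : mon_cat,
    hom A B -> hom A' B' -> hom (tens A A') (tens B B');
  tensA : forall A B C, tens (tens A B) C = tens A (tens B C);
  tensIl : forall A, tens I A = A;
  tensIr : forall A, tens A I = A;
  tensm_id : forall A B, tensm (idm A) (idm B) = idm (tens A B);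
  tensm_comp : forall A B C A' B' C' (f : hom A B) (g : hom B C)
      (f' : hom A' B') (g' : hom B' C'),
    tensm (comp f g) (comp f' g') = comp (tensm f f') (tensm g g');
  tensmA : forall A B A' B' A'' B''
      (f : hom A B) (g : hom A' B') (h : hom A'' B''),
    comp (tensm (tensm f g) h) (idto (tensA B B' B''))
    = comp (idto (tensA A A' A'')) (tensm f (tensm g h));
  tensmIl : forall A B (f : hom A B),
    comp (tensm (idm I) f) (idto (tensIl B)) = comp (idto (tensIl A)) f;
  tensmIr : forall A B (f : hom A B),
    comp (tensm f (idm I)) (idto (tensIr B)) = comp (idto (tensIr A)) f }.

Arguments I {s}.
Arguments tens {s} A B.
Arguments tensm {s A B A' B'} f g.
Arguments tensA {s} A B C.
Arguments tensIl {s} A.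
Arguments tensIr {s} A.

Infix "⊗" := tens (at level 40, left associativity).
Infix "⊗m" := tensm (at level 40, left associativity).

Record StrictSymmetricMonoidalCategory := {
  sym_cat :> StrictMonoidalCategory;
  braid : forall A B : sym_cat, hom (A ⊗ B) (B ⊗ A);
  braid_natural : forall (A B A' B' : sym_cat) (f : hom A B) (f' : hom A' B'),
    comp (f ⊗m f') (braid B B') = comp (braid A A') (f' ⊗m f);
  braid_sym : forall A B, comp (braid A B) (braid B A) = idm (A ⊗ B);
  braid_hexagon : forall A B C,
    comp (braid A (B ⊗ C)) (idto (tensA B C A))
    = comp (idto (eq_sym (tensA A B C)))
        (comp (braid A B ⊗m idm C)
          (comp (idto (tensA B A C)) (idm B ⊗m braid A C))) }.

Arguments braid {s} A B.

Record DistributiveMonoidalCategory := {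
  dist_cat :> StrictSymmetricMonoidalCategory;
  oplus : dist_cat -> dist_cat -> dist_cat;
  inj0 : forall A B, hom A (oplus A B);
  inj1 : forall A B, hom B (oplus A B);
  copairm : forall A B C, hom A C -> hom B C -> hom (oplus A B) C;
  inj0_copairm : forall A B C (f : hom A C) (g : hom B C),
    comp (inj0 A B) (copairm f g) = f;
  inj1_copairm : forall A B C (f : hom A C) (g : hom B C),
    comp (inj1 A B) (copairm f g) = g;
  copairm_unique : forall A B C (f : hom A C) (g : hom B C)
      (h : hom (oplus A B) C),
    comp (inj0 A B) h = f -> comp (inj1 A B) h = g -> h = copairm f g;
  distributive : forall A B C,
    let d : hom (oplus (A ⊗ C) (B ⊗ C)) (oplus A B ⊗ C) :=
      copairm (inj0 A B ⊗m idm C) (inj1 A B ⊗m idm C) in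
    exists d' : hom (oplus A B ⊗ C) (oplus (A ⊗ C) (B ⊗ C)),
      comp d d' = idm _ /\ comp d' d = idm _ }.

Arguments oplus {d} A B.
Arguments inj0 {d} A B.
Arguments inj1 {d} A B.
Arguments copairm {d A B C} f g.

(* Exchanges with choice. Only associativity and unitality are imposed on [⊗],
   so they form the free monoid on the exchanges that are not tensors: an
   exchange is a list of such atoms, [I] is the empty list and [⊗] is
   concatenation. *)

Inductive atom (K : DistributiveMonoidalCategory) : Type :=
| Circ (A : K)
| Bullet (A : K)
| Times (U W : list (atom K))
| Plus (U W : list (atom K)).

Notation exchange K := (list (atom K)).

Arguments Circ {K} A.
Arguments Bullet {K} A.
Arguments Times {K} U W.
Arguments Plus {K} U W.

(* Formal cells with left boundary [U], top [A], bottom [B] and right boundary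
   [W]; the cells of the free cornering with choice are formal cells up to the
   congruence [ceq] below. *)

Inductive cell (K : DistributiveMonoidalCategory) :
    exchange K -> K -> K -> exchange K -> Type :=
| hid (U : exchange K) : cell U I I U
| vid (A : K) : cell [] A A []
| hcomp U A B V A' B' W :
    cell U A B V -> cell V A' B' W -> cell U (A ⊗ A') (B ⊗ B') W
| vcomp U A C W U' B W' :
    cell U A C W -> cell U' C B W' -> cell (U ++ U') A B (W ++ W')
| emb A B : hom A B -> cell [] A B []
| getL A : cell [Circ A] I A []
| putR A : cell [] A I [Circ A]
| getR A : cell [] I A [Bullet A]
| putL A : cell [Bullet A] A I []
| pi0 U W : cell [Times U W] I I U
| pi1 U W : cell [Times U W] I I W
| times V A B U W : cell V A B U -> cell V A B W -> cell V A B [Times U W]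
| iota0 U W : cell U I I [Plus U W]
| iota1 U W : cell W I I [Plus U W]
| plus U A B V W : cell U A B V -> cell W A B V -> cell [Plus U W] A B V
| copair U A B C W : cell U A C W -> cell U B C W -> cell U (oplus A B) C W.

Arguments hid {K} U.
Arguments vid {K} A.
Arguments hcomp {K U A B V A' B' W} α β : rename.
Arguments vcomp {K U A C W U' B W'} α β : rename.
Arguments emb {K A B} f : rename.
Arguments getL {K} A.
Arguments putR {K} A.
Arguments getR {K} A.
Arguments putL {K} A.
Arguments pi0 {K} U W.
Arguments pi1 {K} U W.
Arguments times {K V A B U W} α β : rename.
Arguments iota0 {K} U W.
Arguments iota1 {K} U W.
Arguments plus {K U A B V W} α β : rename.
Arguments copair {K U A B C W} α β : rename.

Reserved Notation "α ≈ β" (at level 70, no associativity).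

(* [ceq] relates formal cells whose boundaries are equal, though not
   necessarily convertible (see [ceq_boundary]): for instance the two sides of
   [ceq_hcompA] have tops [(A ⊗ A') ⊗ A''] and [A ⊗ (A' ⊗ A'')]. *)
Inductive ceq (K : DistributiveMonoidalCategory) :
    forall U A B W U' A' B' W',
      @cell K U A B W -> @cell K U' A' B' W' -> Prop :=
| ceq_refl U A B W (α : cell U A B W) : α ≈ α
| ceq_sym U A B W U' A' B' W' (α : cell U A B W) (β : cell U' A' B' W') :
    α ≈ β -> β ≈ α
| ceq_trans U A B W U' A' B' W' U'' A'' B'' W''
    (α : cell U A B W) (β : cell U' A' B' W') (γ : cell U'' A'' B'' W'') :
    α ≈ β -> β ≈ γ -> α ≈ γ
| ceq_hcomp U1 A1 B1 V1 A1' B1' W1 U2 A2 B2 V2 A2' B2' W2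
    (α1 : cell U1 A1 B1 V1) (β1 : cell V1 A1' B1' W1)
    (α2 : cell U2 A2 B2 V2) (β2 : cell V2 A2' B2' W2) :
    α1 ≈ α2 -> β1 ≈ β2 -> hcomp α1 β1 ≈ hcomp α2 β2
| ceq_vcomp U1 A1 C1 W1 U1' B1 W1' U2 A2 C2 W2 U2' B2 W2'
    (α1 : cell U1 A1 C1 W1) (β1 : cell U1' C1 B1 W1')
    (α2 : cell U2 A2 C2 W2) (β2 : cell U2' C2 B2 W2') :
    α1 ≈ α2 -> β1 ≈ β2 -> vcomp α1 β1 ≈ vcomp α2 β2
| ceq_times V1 A1 B1 U1 W1 V2 A2 B2 U2 W2
    (α1 : cell V1 A1 B1 U1) (β1 : cell V1 A1 B1 W1)
    (α2 : cell V2 A2 B2 U2) (β2 : cell V2 A2 B2 W2) :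
    α1 ≈ α2 -> β1 ≈ β2 -> times α1 β1 ≈ times α2 β2
| ceq_plus U1 A1 B1 V1 W1 U2 A2 B2 V2 W2
    (α1 : cell U1 A1 B1 V1) (β1 : cell W1 A1 B1 V1)
    (α2 : cell U2 A2 B2 V2) (β2 : cell W2 A2 B2 V2) :
    α1 ≈ α2 -> β1 ≈ β2 -> plus α1 β1 ≈ plus α2 β2
| ceq_copair U1 A1 B1 C1 W1 U2 A2 B2 C2 W2
    (α1 : cell U1 A1 C1 W1) (β1 : cell U1 B1 C1 W1)
    (α2 : cell U2 A2 C2 W2) (β2 : cell U2 B2 C2 W2) :
    α1 ≈ α2 -> β1 ≈ β2 -> copair α1 β1 ≈ copair α2 β2
| ceq_hcompA U A B V A' B' V' A'' B'' W
    (α : cell U A B V) (β : cell V A' B' V') (γ : cell V' A'' B'' W) :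
    hcomp (hcomp α β) γ ≈ hcomp α (hcomp β γ)
| ceq_hidl U A B W (α : cell U A B W) : hcomp (hid U) α ≈ α
| ceq_hidr U A B W (α : cell U A B W) : hcomp α (hid W) ≈ α
| ceq_vcompA U A C W U' C' W' U'' B W''
    (α : cell U A C W) (β : cell U' C C' W') (γ : cell U'' C' B W'') :
    vcomp (vcomp α β) γ ≈ vcomp α (vcomp β γ)
| ceq_vidl U A B W (α : cell U A B W) : vcomp (vid A) α ≈ α
| ceq_vidr U A B W (α : cell U A B W) : vcomp α (vid B) ≈ α
| ceq_hid_I : hid [] ≈ vid I
| ceq_vid_tens A B : vid (A ⊗ B) ≈ hcomp (vid A) (vid B)
| ceq_hid_tens U W : hid (U ++ W) ≈ vcomp (hid U) (hid W)
| ceq_interchange U A C V U' B V' A' C' W B' W'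
    (α : cell U A C V) (β : cell U' C B V')
    (γ : cell V A' C' W) (δ : cell V' C' B' W') :
    hcomp (vcomp α β) (vcomp γ δ) ≈ vcomp (hcomp α γ) (hcomp β δ)
| ceq_emb_comp A B C (f : hom A B) (g : hom B C) :
    emb (comp f g) ≈ vcomp (emb f) (emb g)
| ceq_emb_id A : emb (idm A) ≈ vid A
| ceq_emb_tens (A B A' B' : K) (f : hom A B) (g : hom A' B') :
    emb (f ⊗m g) ≈ hcomp (emb f) (emb g)
| ceq_putR_getL A : hcomp (putR A) (getL A) ≈ vid A
| ceq_getL_putR A : vcomp (getL A) (putR A) ≈ hid [Circ A]
| ceq_getR_putL A : hcomp (getR A) (putL A) ≈ vid A
| ceq_getR_putL_v A : vcomp (getR A) (putL A) ≈ hid [Bullet A]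
| ceq_times_pi0 V A B U W (α : cell V A B U) (β : cell V A B W) :
    hcomp (times α β) (pi0 U W) ≈ α
| ceq_times_pi1 V A B U W (α : cell V A B U) (β : cell V A B W) :
    hcomp (times α β) (pi1 U W) ≈ β
| ceq_times_unique V A B U W (α : cell V A B U) (β : cell V A B W)
    (γ : cell V A B [Times U W]) :
    hcomp γ (pi0 U W) ≈ α -> hcomp γ (pi1 U W) ≈ β -> γ ≈ times α β
| ceq_iota0_plus U A B V W (α : cell U A B V) (β : cell W A B V) :
    hcomp (iota0 U W) (plus α β) ≈ α
| ceq_iota1_plus U A B V W (α : cell U A B V) (β : cell W A B V) :
    hcomp (iota1 U W) (plus α β) ≈ β
| ceq_plus_unique U A B V W (α : cell U A B V) (β : cell W A B V)
    (γ : cell [Plus U W] A B V) :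
    hcomp (iota0 U W) γ ≈ α -> hcomp (iota1 U W) γ ≈ β -> γ ≈ plus α β
| ceq_inj0_copair U A B C W (α : cell U A C W) (β : cell U B C W) :
    vcomp (emb (inj0 A B)) (copair α β) ≈ α
| ceq_inj1_copair U A B C W (α : cell U A C W) (β : cell U B C W) :
    vcomp (emb (inj1 A B)) (copair α β) ≈ β
| ceq_copair_unique U A B C W (α : cell U A C W) (β : cell U B C W)
    (γ : cell U (oplus A B) C W) :
    vcomp (emb (inj0 A B)) γ ≈ α -> vcomp (emb (inj1 A B)) γ ≈ β ->
    γ ≈ copair α β
where "α ≈ β" := (ceq α β).

Definition recast (K : DistributiveMonoidalCategory)
    (U U' : exchange K) (A A' B B' : K) (W W' : exchange K)
    (eU : U = U') (eA : A = A') (eB : B = B') (eW : W = W')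
    (α : cell U A B W) : cell U' A' B' W' :=
  match eU in _ = U', eA in _ = A', eB in _ = B', eW in _ = W'
    return cell U' A' B' W'
  with eq_refl, eq_refl, eq_refl, eq_refl => α end.

Lemma ceq_recast (K : DistributiveMonoidalCategory)
    (U U' : exchange K) (A A' B B' : K) (W W' : exchange K)
    (eU : U = U') (eA : A = A') (eB : B = B') (eW : W = W')
    (α : cell U A B W) : recast eU eA eB eW α ≈ α.
Proof. destruct eU, eA, eB, eW; apply ceq_refl. Qed.

Lemma ceq_boundary (K : DistributiveMonoidalCategory)
    (U : exchange K) (A B : K) (W U' : exchange K) (A' B' : K) (W' : exchange K)
    (α : cell U A B W) (β : cell U' A' B' W') :
  α ≈ β -> U = U' /\ A = A' /\ B = B' /\ W = W'.
Proof.
  induction 1;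
    repeat match goal with H : _ /\ _ |- _ => destruct H end; subst;
    rewrite ?tensA, ?tensIl, ?tensIr, ?app_nil_r, <- ?app_assoc; auto.
Qed.

Definition sigma (K : DistributiveMonoidalCategory) (A B : K) :
  cell [] (A ⊗ B) (B ⊗ A) [] := emb (braid A B).

(* [chi_list c] extends crossing cells [c] of atoms to exchanges by
   [χ_I = 1_C] and [χ_(U ⊗ W) = χ_U / χ_W]. *)
Definition chi_list (K : DistributiveMonoidalCategory) (C : K)
    (c : forall a : atom K, cell [a] C C [a]) :
    forall U : exchange K, cell U C C U :=
  fix chi_list U :=
    match U return cell U C C U with
    | [] => vid C
    | a :: U' => vcomp (c a) (chi_list U')
    end.

Fixpoint chi_atom (K : DistributiveMonoidalCategory) (C : K) (a : atom K) :
    cell [a] C C [a] :=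
  match a return cell [a] C C [a] with
  | Circ A =>
      recast eq_refl (tensIl C) (tensIr C) eq_refl
        (vcomp (hcomp (getL A) (vid C))
          (vcomp (sigma A C) (hcomp (vid C) (putR A))))
  | Bullet A =>
      recast eq_refl (tensIr C) (tensIl C) eq_refl
        (vcomp (hcomp (vid C) (getR A))
          (vcomp (sigma C A) (hcomp (putL A) (vid C))))
  | Times U W =>
      recast eq_refl (tensIl C) (tensIl C) eq_refl
        (times (hcomp (pi0 U W) (chi_list (chi_atom C) U))
               (hcomp (pi1 U W) (chi_list (chi_atom C) W)))
  | Plus U W =>
      recast eq_refl (tensIr C) (tensIr C) eq_refl
        (plus (hcomp (chi_list (chi_atom C) U) (iota0 U W))
              (hcomp (chi_list (chi_atom C) W) (iota1 U W)))
  end.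

Definition chi (K : DistributiveMonoidalCategory) (U : exchange K) (C : K) :
  cell U C C U := chi_list (chi_atom C) U.

(* Since [chi] is defined on lists of atoms and recasts its top and bottom, the
   usual inductive clauses for crossing cells hold up to [≈]. *)

Lemma chi_I (K : DistributiveMonoidalCategory) (C : K) : chi [] C ≈ vid C.
Proof. apply ceq_refl. Qed.

Lemma chi_tens (K : DistributiveMonoidalCategory) (U W : exchange K) (C : K) :
  chi (U ++ W) C ≈ vcomp (chi U C) (chi W C).
Proof.
  induction U as [|a U IH].
  - apply ceq_sym, (ceq_vidl (chi W C)).
  - exact (ceq_trans (ceq_vcomp (ceq_refl (chi_atom C a)) IH)
      (ceq_sym (ceq_vcompA (chi_atom C a) (chi U C) (chi W C)))).
Qed.

Lemma chi_Circ (K : DistributiveMonoidalCategory) (A C : K) :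
  chi [Circ A] C
  ≈ vcomp (vcomp (hcomp (getL A) (vid C)) (sigma A C)) (hcomp (vid C) (putR A)).
Proof.
  refine (ceq_trans (ceq_vidr (chi_atom C (Circ A))) _).
  refine (ceq_trans (ceq_recast _ _ _ _ _) _).
  apply ceq_sym, ceq_vcompA.
Qed.

Lemma chi_Bullet (K : DistributiveMonoidalCategory) (A C : K) :
  chi [Bullet A] C
  ≈ vcomp (vcomp (hcomp (vid C) (getR A)) (sigma C A)) (hcomp (putL A) (vid C)).
Proof.
  refine (ceq_trans (ceq_vidr (chi_atom C (Bullet A))) _).
  refine (ceq_trans (ceq_recast _ _ _ _ _) _).
  apply ceq_sym, ceq_vcompA.
Qed.

Lemma chi_Plus (K : DistributiveMonoidalCategory) (U W : exchange K) (C : K) :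
  chi [Plus U W] C
  ≈ plus (hcomp (chi U C) (iota0 U W)) (hcomp (chi W C) (iota1 U W)).
Proof.
  refine (ceq_trans (ceq_vidr (chi_atom C (Plus U W))) _).
  apply ceq_recast.
Qed.

Lemma chi_Times (K : DistributiveMonoidalCategory) (U W : exchange K) (C : K) :
  chi [Times U W] C
  ≈ times (hcomp (pi0 U W) (chi U C)) (hcomp (pi1 U W) (chi W C)).
Proof.
  refine (ceq_trans (ceq_vidr (chi_atom C (Times U W))) _).
  apply ceq_recast.
Qed.

(* Main.v *)
Require Import Defs.
From Stdlib Require Import List.
Import ListNotations.

(** By induction on the cell [α]. The structural cells use the two hexagons, the
    coherence [σ_(A,I) = σ_(I,A) = 1_A] and naturality of the braiding; for the
    corner cells, the yanking equations collapse [χ] to the braiding. For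
    [α × β] and [α + β] the two sides agree after composition with the
    projections, resp. injections, because these commute with [χ]. For
    [[α, β]], distributivity says that cells with top [(A ⊕ B) ⊗ C] are
    determined by their composites with [σ_0 ⊗ 1_C] and [σ_1 ⊗ 1_C]. *)

Set Implicit Arguments.
Unset Strict Implicit.
Unset Printing Implicit Defensive.

(* Composites of cells whose common boundaries are only propositionally equal.
   The proof of equality is irrelevant up to [≈] ([hc_cong], [vc_cong]), so no
   uniqueness of identity proofs on objects is needed. It is the last argument
   so that the boundaries are known when [solve_boundary] runs. *)
Definition hc (K : DistributiveMonoidalCategory)
    (U : exchange K) (A B : K) (V V' : exchange K) (A' B' : K) (W : exchange K)
    (α : cell U A B V) (β : cell V' A' B' W) (e : V = V') :
    cell U (A ⊗ A') (B ⊗ B') W :=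
  hcomp (recast eq_refl eq_refl eq_refl e α) β.

Definition vc (K : DistributiveMonoidalCategory)
    (U : exchange K) (A C : K) (W U' : exchange K) (C' B : K) (W' : exchange K)
    (α : cell U A C W) (β : cell U' C' B W') (e : C = C') :
    cell (U ++ U') A B (W ++ W') :=
  vcomp (recast eq_refl eq_refl e eq_refl α) β.

(** [reflexivity] is tried first, so that composites with convertible boundaries carry [eq_refl] and
    reduce to plain [hcomp] and [vcomp]. *)
Ltac solve_boundary :=
  first
    [ reflexivity
    | assumption
    | simpl; rewrite ?tensA, ?tensIl, ?tensIr, ?app_nil_r, <- ?app_assoc;
      congruence ].

Notation "α '∣' β" := (hc α β ltac:(solve_boundary))
  (at level 45, left associativity, only parsing).
Notation "α '⁄' β" := (vc α β ltac:(solve_boundary))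
  (at level 50, left associativity, only parsing).

Tactic Notation "trans" uconstr(t) := refine (ceq_trans (β := t) _ _).

(** * Composites along propositionally equal boundaries *)

Section Composites.

Context {K : DistributiveMonoidalCategory}.

Lemma hc_cong (U1 : exchange K) A1 B1 V1 V1' A1' B1' W1 U2 A2 B2 V2 V2' A2' B2' W2
    (e1 : V1 = V1') (e2 : V2 = V2')
    (α1 : cell U1 A1 B1 V1) (β1 : cell V1' A1' B1' W1)
    (α2 : cell U2 A2 B2 V2) (β2 : cell V2' A2' B2' W2) :
  α1 ≈ α2 -> β1 ≈ β2 -> hc α1 β1 e1 ≈ hc α2 β2 e2.
Proof.
  intros Hα Hβ. apply ceq_hcomp; [|exact Hβ].
  refine (ceq_trans (ceq_recast _ _ _ _ _) (ceq_trans Hα _)).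
  apply ceq_sym, ceq_recast.
Qed.

Lemma vc_cong (U1 : exchange K) A1 C1 W1 U1' C1' B1 W1' U2 A2 C2 W2 U2' C2' B2 W2'
    (e1 : C1 = C1') (e2 : C2 = C2')
    (α1 : cell U1 A1 C1 W1) (β1 : cell U1' C1' B1 W1')
    (α2 : cell U2 A2 C2 W2) (β2 : cell U2' C2' B2 W2') :
  α1 ≈ α2 -> β1 ≈ β2 -> vc α1 β1 e1 ≈ vc α2 β2 e2.
Proof.
  intros Hα Hβ. apply ceq_vcomp; [|exact Hβ].
  refine (ceq_trans (ceq_recast _ _ _ _ _) (ceq_trans Hα _)).
  apply ceq_sym, ceq_recast.
Qed.

(** The equalities on the two sides are quantified independently, so that the law applies whatever
    boundary proofs the composites carry; likewise for [vc_assoc] and [interchange]. *)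
Lemma hc_assoc (U : exchange K) A B V1 V2 A' B' V1' V2' A'' B'' W
    (e1 e4 : V1 = V2) (e2 e3 : V1' = V2')
    (α : cell U A B V1) (β : cell V2 A' B' V1') (γ : cell V2' A'' B'' W) :
  hc (hc α β e1) γ e2 ≈ hc α (hc β γ e3) e4.
Proof.
  subst V2 V2'.
  refine (ceq_trans (β := hcomp (hcomp α β) γ) _ (ceq_trans (ceq_hcompA _ _ _) _)).
  - apply (hc_cong _ eq_refl); [apply (hc_cong _ eq_refl)|]; apply ceq_refl.
  - apply (hc_cong eq_refl _); [|apply (hc_cong eq_refl _)]; apply ceq_refl.
Qed.

Lemma vc_assoc (U : exchange K) A C1 C2 W U' C1' C2' W' U'' B W''
    (e1 e4 : C1 = C2) (e2 e3 : C1' = C2')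
    (α : cell U A C1 W) (β : cell U' C2 C1' W') (γ : cell U'' C2' B W'') :
  vc (vc α β e1) γ e2 ≈ vc α (vc β γ e3) e4.
Proof.
  subst C2 C2'.
  refine (ceq_trans (β := vcomp (vcomp α β) γ) _ (ceq_trans (ceq_vcompA _ _ _) _)).
  - apply (vc_cong _ eq_refl); [apply (vc_cong _ eq_refl)|]; apply ceq_refl.
  - apply (vc_cong eq_refl _); [|apply (vc_cong eq_refl _)]; apply ceq_refl.
Qed.

Lemma interchange (U : exchange K) A C1 C2 V1 V2 U' B V1' V2' A' C1' C2' W B' W'
    (e : V1 ++ V1' = V2 ++ V2') (e1 : C1 = C2) (e2 : C1' = C2')
    (e' : C1 ⊗ C1' = C2 ⊗ C2') (e3 : V1 = V2) (e4 : V1' = V2')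
    (α : cell U A C1 V1) (β : cell U' C2 B V1')
    (γ : cell V2 A' C1' W) (δ : cell V2' C2' B' W') :
  hc (vc α β e1) (vc γ δ e2) e ≈ vc (hc α γ e3) (hc β δ e4) e'.
Proof.
  subst C2 C2' V2 V2'.
  refine (ceq_trans (β := hcomp (vcomp α β) (vcomp γ δ)) _
    (ceq_trans (ceq_interchange _ _ _ _) _)).
  - apply (hc_cong _ eq_refl); apply ceq_refl.
  - apply (vc_cong eq_refl _); apply ceq_refl.
Qed.

(** Here and in the three companion lemmas [ι] is any cell congruent to an identity, so that [vid I]
    or [sigma A I] can be cancelled in place; [ceq_boundary] supplies the boundaries of [ι]. *)
Lemma hc_idl (U : exchange K) A B W V A1 B1 V1 X (e : V1 = U)
    (ι : cell V A1 B1 V1) (α : cell U A B W) : ι ≈ hid X -> hc ι α e ≈ α.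
Proof.
  intros Hι. destruct (ceq_boundary Hι) as (-> & -> & -> & ->). subst X.
  refine (ceq_trans _ (ceq_hidl α)).
  apply (hc_cong _ eq_refl); [exact Hι | apply ceq_refl].
Qed.

Lemma hc_idr (U : exchange K) A B W V A1 B1 V1 X (e : W = V)
    (ι : cell V A1 B1 V1) (α : cell U A B W) : ι ≈ hid X -> hc α ι e ≈ α.
Proof.
  intros Hι. destruct (ceq_boundary Hι) as (-> & -> & -> & ->). subst X.
  refine (ceq_trans _ (ceq_hidr α)).
  apply (hc_cong _ eq_refl); [apply ceq_refl | exact Hι].
Qed.

Lemma vc_idl (U : exchange K) A B W V A1 B1 V1 X (e : B1 = A)
    (ι : cell V A1 B1 V1) (α : cell U A B W) : ι ≈ vid X -> vc ι α e ≈ α.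
Proof.
  intros Hι. destruct (ceq_boundary Hι) as (-> & -> & -> & ->). subst X.
  refine (ceq_trans _ (ceq_vidl α)).
  apply (vc_cong _ eq_refl); [exact Hι | apply ceq_refl].
Qed.

Lemma vc_idr (U : exchange K) A B W V A1 B1 V1 X (e : B = A1)
    (ι : cell V A1 B1 V1) (α : cell U A B W) : ι ≈ vid X -> vc α ι e ≈ α.
Proof.
  intros Hι. destruct (ceq_boundary Hι) as (-> & -> & -> & ->). subst X.
  refine (ceq_trans _ (ceq_vidr α)).
  apply (vc_cong _ eq_refl); [apply ceq_refl | exact Hι].
Qed.

Lemma vid_I : vid I ≈ @hid K [].
Proof. apply ceq_sym, ceq_hid_I. Qed.

(** * Joint cancellation of projections and of injections *)

Lemma times_ext (U W : exchange K) V A B V' A' B' X X'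
    (e : X = [Times U W]) (e' : X' = [Times U W]) (eV : V = V') (eA : A = A') (eB : B = B')
    (γ : cell V A B X) (γ' : cell V' A' B' X') :
  hc γ (pi0 U W) e ≈ hc γ' (pi0 U W) e' ->
  hc γ (pi1 U W) e ≈ hc γ' (pi1 U W) e' -> γ ≈ γ'.
Proof.
  subst. intros H0 H1.
  refine (ceq_trans _ (ceq_sym _)).
  (* The components are the composites of [γ] with the projections, recast because these carry an
     extra factor [I] on top and bottom. *)
  - refine (ceq_times_unique (α := recast eq_refl (tensIr _) (tensIr _) eq_refl
        (hcomp γ (pi0 U W))) (β := recast eq_refl (tensIr _) (tensIr _) eq_refl
        (hcomp γ (pi1 U W))) _ _); apply ceq_sym, ceq_recast.
  - apply ceq_times_unique; (refine (ceq_trans (ceq_sym _) (ceq_sym (ceq_recast _ _ _ _ _))));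
      assumption.
Qed.

Lemma plus_ext (U W : exchange K) V A B V' A' B' X X'
    (e : [Plus U W] = X) (e' : [Plus U W] = X') (eV : V = V') (eA : A = A') (eB : B = B')
    (γ : cell X A B V) (γ' : cell X' A' B' V') :
  hc (iota0 U W) γ e ≈ hc (iota0 U W) γ' e' ->
  hc (iota1 U W) γ e ≈ hc (iota1 U W) γ' e' -> γ ≈ γ'.
Proof.
  subst. intros H0 H1.
  refine (ceq_trans _ (ceq_sym _)).
  - refine (ceq_plus_unique (α := recast eq_refl (tensIl _) (tensIl _) eq_refl
        (hcomp (iota0 U W) γ)) (β := recast eq_refl (tensIl _) (tensIl _) eq_refl
        (hcomp (iota1 U W) γ)) _ _); apply ceq_sym, ceq_recast.
  - apply ceq_plus_unique; (refine (ceq_trans (ceq_sym _) (ceq_sym (ceq_recast _ _ _ _ _))));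
      assumption.
Qed.

Lemma copair_ext (A B : K) U C W (γ γ' : cell U (oplus A B) C W) :
  vcomp (emb (inj0 A B)) γ ≈ vcomp (emb (inj0 A B)) γ' ->
  vcomp (emb (inj1 A B)) γ ≈ vcomp (emb (inj1 A B)) γ' -> γ ≈ γ'.
Proof.
  intros H0 H1.
  refine (ceq_trans _ (ceq_sym _)).
  - exact (ceq_copair_unique (α := vcomp (emb (inj0 A B)) γ)
      (β := vcomp (emb (inj1 A B)) γ) (ceq_refl _) (ceq_refl _)).
  - apply ceq_copair_unique; apply ceq_sym; assumption.
Qed.

Lemma emb_idto (A B : K) (e : A = B) : emb (idto e) ≈ vid A.
Proof. destruct e; apply ceq_emb_id. Qed.

Lemma emb_tens_id_r (A B C : K) (f : hom A B) : emb (f ⊗m idm C) ≈ emb f ∣ vid C.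
Proof.
  refine (ceq_trans (ceq_emb_tens _ _) _).
  apply (hc_cong eq_refl); [apply ceq_refl | apply ceq_emb_id].
Qed.

Lemma emb_tens_id_l (A B C : K) (f : hom A B) : emb (idm C ⊗m f) ≈ vid C ∣ emb f.
Proof.
  refine (ceq_trans (ceq_emb_tens _ _) _).
  apply (hc_cong eq_refl); [apply ceq_emb_id | apply ceq_refl].
Qed.

(** Distributivity inverts the canonical map [d] out of [oplus (A ⊗ C) (B ⊗ C)], so [emb d] can be
    cancelled from the top; the resulting cells have a coproduct as top and are separated by
    [copair_ext]. *)
Lemma copair_tens_ext (A B C : K) U D W U' A' D' W' (eA : oplus A B ⊗ C = A')
    (eU : U = U') (eD : D = D') (eW : W = W')
    (γ : cell U (oplus A B ⊗ C) D W) (γ' : cell U' A' D' W') :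
  emb (inj0 A B) ∣ vid C ⁄ γ ≈ emb (inj0 A B) ∣ vid C ⁄ γ' ->
  emb (inj1 A B) ∣ vid C ⁄ γ ≈ emb (inj1 A B) ∣ vid C ⁄ γ' -> γ ≈ γ'.
Proof.
  subst. intros H0 H1.
  destruct (distributive A B C) as (d' & _ & Hd). cbv zeta in Hd.
  set (d := copairm _ _) in *.
  assert (E : forall δ : cell U' (oplus A B ⊗ C) D' W',
    vcomp (emb d') (vcomp (emb d) δ) ≈ δ).
  { intros δ. refine (ceq_trans (ceq_sym (ceq_vcompA _ _ _)) _).
    apply (vc_idl eq_refl (X := oplus A B ⊗ C)).
    refine (ceq_trans (ceq_sym (ceq_emb_comp _ _)) _).
    rewrite Hd. apply ceq_emb_id. }
  refine (ceq_trans (ceq_sym (E γ)) (ceq_trans _ (E γ'))).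
  apply ceq_vcomp; [apply ceq_refl|].
  (* An injection followed by [d] is that injection tensored with [idm C], which turns the goals of
     [copair_ext] into [H0] and [H1]. *)
  assert (E0 : forall δ : cell U' (oplus A B ⊗ C) D' W',
    vcomp (emb (inj0 _ _)) (vcomp (emb d) δ) ≈ emb (inj0 A B) ∣ vid C ⁄ δ).
  { intros δ. refine (ceq_trans (ceq_sym (ceq_vcompA _ _ _)) _).
    apply (vc_cong eq_refl); [|apply ceq_refl].
    refine (ceq_trans (ceq_sym (ceq_emb_comp _ _)) _).
    unfold d. rewrite inj0_copairm. apply emb_tens_id_r. }
  assert (E1 : forall δ : cell U' (oplus A B ⊗ C) D' W',
    vcomp (emb (inj1 _ _)) (vcomp (emb d) δ) ≈ emb (inj1 A B) ∣ vid C ⁄ δ).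
  { intros δ. refine (ceq_trans (ceq_sym (ceq_vcompA _ _ _)) _).
    apply (vc_cong eq_refl); [|apply ceq_refl].
    refine (ceq_trans (ceq_sym (ceq_emb_comp _ _)) _).
    unfold d. rewrite inj1_copairm. apply emb_tens_id_r. }
  apply copair_ext.
  - refine (ceq_trans (E0 γ) (ceq_trans H0 (ceq_sym (E0 γ')))).
  - refine (ceq_trans (E1 γ) (ceq_trans H1 (ceq_sym (E1 γ')))).
Qed.

End Composites.

Ltac congr :=
  repeat first [ apply ceq_refl | assumption | apply ceq_sym; assumption
               | apply hc_cong | apply vc_cong ].

(** * Coherence of the symmetric braiding *)

Section Braiding.

Context {K : DistributiveMonoidalCategory}.
Implicit Types A B C : K.

Lemma sigma_sym A B (e : B ⊗ A = B ⊗ A) : vc (sigma A B) (sigma B A) e ≈ vid (A ⊗ B).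
Proof.
  trans (vcomp (sigma A B) (sigma B A)).
  { apply (vc_cong e eq_refl); apply ceq_refl. }
  refine (ceq_trans (ceq_sym (ceq_emb_comp _ _)) _).
  rewrite braid_sym. apply ceq_emb_id.
Qed.

Lemma sigma_natural A B A' B' (f : hom A B) (f' : hom A' B') :
  emb f ∣ emb f' ⁄ sigma B B' ≈ sigma A A' ⁄ (emb f' ∣ emb f).
Proof.
  trans (emb (comp (f ⊗m f') (braid B B'))).
  - refine (ceq_sym (ceq_trans (ceq_emb_comp _ _) _)).
    apply (vc_cong eq_refl); [apply ceq_emb_tens | apply ceq_refl].
  - rewrite braid_natural. refine (ceq_trans (ceq_emb_comp _ _) _).
    apply (vc_cong eq_refl); [apply ceq_refl | apply ceq_emb_tens].
Qed.

(** This is [braid_hexagon]: each [idto] embeds as an identity cell and disappears up to [≈]. *)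
Lemma sigma_tens_r A B C :
  sigma A (B ⊗ C) ≈ (sigma A B ∣ vid C) ⁄ (vid B ∣ sigma A C).
Proof.
  trans (emb (comp (braid A (B ⊗ C)) (idto (tensA B C A)))).
  - apply ceq_sym. refine (ceq_trans (ceq_emb_comp _ _) _).
    apply (vc_idr eq_refl _ (emb_idto _)).
  - rewrite braid_hexagon.
    refine (ceq_trans (ceq_emb_comp _ _) _).
    refine (ceq_trans (vc_idl eq_refl _ (emb_idto _)) _).
    refine (ceq_trans (ceq_emb_comp _ _) _).
    apply (vc_cong eq_refl); [apply emb_tens_id_r|].
    refine (ceq_trans (ceq_emb_comp _ _) _).
    refine (ceq_trans (vc_idl eq_refl _ (emb_idto _)) _).
    apply emb_tens_id_l.
Qed.

Lemma sigma_cong A B A' B' : A = A' -> B = B' -> sigma A B ≈ sigma A' B'.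
Proof. intros -> ->; apply ceq_refl. Qed.

(* By the hexagon [σ_(A,I)] is idempotent, and it is invertible. *)
Lemma sigma_I_r A : sigma A I ≈ vid A.
Proof.
  assert (E : sigma A I ≈ sigma A I ⁄ sigma A I).
  { trans (sigma A (I ⊗ I)).
    - apply sigma_cong; [|rewrite tensIl]; reflexivity.
    - refine (ceq_trans (sigma_tens_r _ _ _) _).
      apply vc_cong; [apply (hc_idr _ _ vid_I) | apply (hc_idl _ _ vid_I)]. }
  trans (sigma I A ⁄ sigma A I ⁄ sigma A I).
  - apply ceq_sym, (vc_idl _ _ (sigma_sym _)).
  - trans (sigma I A ⁄ (sigma A I ⁄ sigma A I)); [apply vc_assoc|].
    trans (sigma I A ⁄ sigma A I); [congr|].
    refine (ceq_trans (sigma_sym _) _).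
    rewrite tensIl. apply ceq_refl.
Qed.

Lemma sigma_I_l A : sigma I A ≈ vid A.
Proof.
  trans (sigma I A ⁄ sigma A I).
  - apply ceq_sym, (vc_idr _ _ (sigma_I_r A)).
  - refine (ceq_trans (sigma_sym _) _). rewrite tensIl. apply ceq_refl.
Qed.

(** Followed by [sigma C (A ⊗ B)], the right-hand side becomes an identity, by the other hexagon and
    symmetry; and [sigma C (A ⊗ B)] has inverse [sigma (A ⊗ B) C]. *)
Lemma sigma_tens_l A B C :
  sigma (A ⊗ B) C ≈ (vid A ∣ sigma B C) ⁄ (sigma A C ∣ vid B).
Proof.
  assert (E : ((vid A ∣ sigma B C) ⁄ (sigma A C ∣ vid B)) ⁄ sigma C (A ⊗ B)
     ≈ vid (A ⊗ B ⊗ C)).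
  { trans (((vid A ∣ sigma B C) ⁄ (sigma A C ∣ vid B)) ⁄
       ((sigma C A ∣ vid B) ⁄ (vid A ∣ sigma C B))).
    { congr. apply sigma_tens_r. }
    trans ((vid A ∣ sigma B C) ⁄ ((sigma A C ∣ vid B) ⁄
       ((sigma C A ∣ vid B) ⁄ (vid A ∣ sigma C B)))); [apply vc_assoc|].
    trans ((vid A ∣ sigma B C) ⁄ (((sigma A C ∣ vid B) ⁄
       (sigma C A ∣ vid B)) ⁄ (vid A ∣ sigma C B))).
    { apply vc_cong; [apply ceq_refl | apply ceq_sym, vc_assoc]. }
    (* The adjacent braidings of [A] and [C] cancel first, then those of [B] and [C]. *)
    trans ((vid A ∣ sigma B C) ⁄ (vid A ∣ sigma C B)).
    { congr. refine (vc_idl (X := A ⊗ C ⊗ B) _ _ _).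
      trans ((sigma A C ⁄ sigma C A) ∣ (vid B ⁄ vid B));
        [apply ceq_sym, interchange; reflexivity|].
      refine (ceq_trans _ (ceq_sym (ceq_vid_tens _ _))).
      apply (hc_cong _ eq_refl); [apply sigma_sym | apply ceq_vidl]. }
    trans ((vid A ⁄ vid A) ∣ (sigma B C ⁄ sigma C B));
        [apply ceq_sym, interchange; reflexivity|].
    rewrite tensA.
    refine (ceq_trans _ (ceq_sym (ceq_vid_tens _ _))).
    apply (hc_cong _ eq_refl); [apply ceq_vidl | apply sigma_sym]. }
  trans (((vid A ∣ sigma B C) ⁄ (sigma A C ∣ vid B)) ⁄ sigma C (A ⊗ B) ⁄ sigma (A ⊗ B) C).
  - apply ceq_sym, (vc_idl _ _ E).
  - trans (((vid A ∣ sigma B C) ⁄ (sigma A C ∣ vid B)) ⁄ (sigma C (A ⊗ B) ⁄ sigma (A ⊗ B) C)).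
    + apply vc_assoc.
    + apply (vc_idr _ _ (sigma_sym _)).
Qed.

End Braiding.

(** * The crossing equation for identities and composites *)

Section Crossing.

Context {K : DistributiveMonoidalCategory}.
Implicit Types A B C : K.

(** Padding [ρ] below with [vid I] makes interchange applicable, and the lower row absorbs [vid I]
    as [hid []]. The three variants put [ρ] on the other side or in the lower row. *)
Lemma hc_vc_upper_r (U : exchange K) A C1 V U' C2 B V' W
    (α : cell U A C1 V) (β : cell U' C2 B []) (ρ : cell V' I I W)
    (e1 : C1 = C2) (e2 : V ++ [] = V') (e3 : V = V') (e4 : C1 ⊗ I = C2) :
  hc (vc α β e1) ρ e2 ≈ vc (hc α ρ e3) β e4.
Proof.
  trans (vc α β e1 ∣ (ρ ⁄ @vid K I)).
  - apply hc_cong; [apply ceq_refl | apply ceq_sym, ceq_vidr].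
  - trans (α ∣ ρ ⁄ (β ∣ @vid K I)); [apply interchange|].
    apply vc_cong; [congr | apply (hc_idr _ _ vid_I)].
Qed.

Lemma hc_vc_lower_r (U : exchange K) A C1 V U' C2 B V' W
    (α : cell U A C1 []) (β : cell U' C2 B V) (ρ : cell V' I I W)
    (e1 : C1 = C2) (e2 : V = V') (e3 : V = V') (e4 : C1 = C2 ⊗ I) :
  hc (vc α β e1) ρ e2 ≈ vc α (hc β ρ e3) e4.
Proof.
  trans (vc α β e1 ∣ (@vid K I ⁄ ρ)).
  - apply hc_cong; [apply ceq_refl | apply ceq_sym, ceq_vidl].
  - trans (α ∣ @vid K I ⁄ (β ∣ ρ)); [apply interchange|].
    apply vc_cong; [apply (hc_idr _ _ vid_I) | congr].
Qed.

Lemma hc_vc_upper_l (U : exchange K) A C1 V U' C2 B V' W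
    (ρ : cell W I I V') (α : cell V A C1 U) (β : cell [] C2 B U')
    (e1 : C1 = C2) (e2 : V' = V ++ []) (e3 : V' = V) (e4 : I ⊗ C1 = C2) :
  hc ρ (vc α β e1) e2 ≈ vc (hc ρ α e3) β e4.
Proof.
  trans ((ρ ⁄ @vid K I) ∣ vc α β e1).
  - apply hc_cong; [apply ceq_sym, ceq_vidr | apply ceq_refl].
  - trans (ρ ∣ α ⁄ (@vid K I ∣ β)); [apply interchange|].
    apply vc_cong; [congr | apply (hc_idl _ _ vid_I)].
Qed.

Lemma hc_vc_lower_l (U : exchange K) A C1 V U' C2 B V' W
    (ρ : cell W I I V') (α : cell [] A C1 U) (β : cell V C2 B U')
    (e1 : C1 = C2) (e2 : V' = V) (e3 : V' = V) (e4 : C1 = I ⊗ C2) :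
  hc ρ (vc α β e1) e2 ≈ vc α (hc ρ β e3) e4.
Proof.
  trans ((@vid K I ⁄ ρ) ∣ vc α β e1).
  - apply hc_cong; [apply ceq_sym, ceq_vidl | apply ceq_refl].
  - trans (@vid K I ∣ α ⁄ (ρ ∣ β)); [apply interchange|].
    apply vc_cong; [apply (hc_idl _ _ vid_I) | congr].
Qed.

(** The equation of the theorem without its recasting: the side boundaries [U ++ []] and [U], and [W
    ++ []] and [W], need not be convertible under [≈]. *)
Definition crosses (C : K) U A B W (α : cell U A B W) : Prop :=
  α ∣ chi W C ⁄ sigma B C ≈ sigma A C ⁄ (chi U C ∣ α).

(** Both braidings are [sigma I C], an identity, so only sliding past [chi] remains; this serves
    horizontal units, projections and injections. *)
Lemma crosses_I C U W (ρ : cell U I I W) :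
  ρ ∣ chi W C ≈ chi U C ∣ ρ -> crosses C ρ.
Proof.
  intros H. unfold crosses.
  refine (ceq_trans (vc_idr _ _ (sigma_I_l C)) _).
  refine (ceq_trans H _).
  apply ceq_sym, (vc_idl _ _ (sigma_I_l C)).
Qed.

Lemma crosses_hid C U : crosses C (hid U).
Proof.
  apply crosses_I.
  exact (ceq_trans (ceq_hidl _) (ceq_sym (ceq_hidr _))).
Qed.

Lemma crosses_vid C A : crosses C (vid A).
Proof.
  refine (ceq_trans (vc_idl _ _ (ceq_sym (ceq_vid_tens _ _))) _).
  apply ceq_sym, (vc_idr _ _ (ceq_sym (ceq_vid_tens _ _))).
Qed.

(** The braiding splits by [sigma_tens_l]. Crossing [β] moves [chi] from the right boundary to the
    middle one, and crossing [α] moves it on to the left. *)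
Lemma crosses_hcomp C U A B V A' B' W
    (α : cell U A B V) (β : cell V A' B' W) :
  crosses C α -> crosses C β -> crosses C (hcomp α β).
Proof.
  intros Hα Hβ.
  trans ((α ∣ (β ∣ chi W C)) ⁄ ((vid B ∣ sigma B' C) ⁄ (sigma B C ∣ vid B'))).
  { apply vc_cong; [apply (hc_assoc eq_refl) | apply sigma_tens_l]. }
  trans ((α ∣ (β ∣ chi W C)) ⁄ (vid B ∣ sigma B' C) ⁄ (sigma B C ∣ vid B')).
  { apply ceq_sym, vc_assoc. }
  (* The right-hand column is now one side of the crossing equation of [β]. *)
  trans (((α ⁄ vid B) ∣ (β ∣ chi W C ⁄ sigma B' C)) ⁄ (sigma B C ∣ vid B')).
  { apply vc_cong; [apply ceq_sym, interchange; reflexivity | congr]. }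
  trans (((vid A ⁄ α) ∣ (sigma A' C ⁄ (chi V C ∣ β))) ⁄ (sigma B C ∣ vid B')).
  { apply vc_cong; [apply hc_cong; [|exact Hβ] | congr].
    exact (ceq_trans (ceq_vidr _) (ceq_sym (ceq_vidl _))). }
  trans ((vid A ∣ sigma A' C) ⁄ (α ∣ (chi V C ∣ β)) ⁄ (sigma B C ∣ vid B')).
  { apply vc_cong; [apply interchange | congr]. }
  trans ((vid A ∣ sigma A' C) ⁄ ((α ∣ chi V C) ∣ β ⁄ (sigma B C ∣ vid B'))).
  { trans ((vid A ∣ sigma A' C) ⁄ ((α ∣ (chi V C ∣ β)) ⁄ (sigma B C ∣ vid B'))).
    { apply vc_assoc. }
    apply vc_cong; [congr | apply vc_cong; [apply ceq_sym, hc_assoc | congr]]. }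
  (* Regrouping makes the left-hand column one side of the crossing equation of [α]. *)
  trans ((vid A ∣ sigma A' C) ⁄ ((α ∣ chi V C ⁄ sigma B C) ∣ (β ⁄ vid B'))).
  { apply vc_cong; [congr | apply ceq_sym, interchange]. }
  trans ((vid A ∣ sigma A' C) ⁄ ((sigma A C ⁄ (chi U C ∣ α)) ∣ (vid A' ⁄ β))).
  { apply vc_cong; [congr | apply hc_cong; [exact Hα|]].
    exact (ceq_trans (ceq_vidr _) (ceq_sym (ceq_vidl _))). }
  trans ((vid A ∣ sigma A' C) ⁄ ((sigma A C ∣ vid A') ⁄ ((chi U C ∣ α) ∣ β))).
  { apply vc_cong; [congr | apply interchange; reflexivity]. }
  trans ((vid A ∣ sigma A' C) ⁄ (sigma A C ∣ vid A') ⁄ ((chi U C ∣ α) ∣ β)).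
  { apply ceq_sym, vc_assoc. }
  apply vc_cong; [apply ceq_sym, sigma_tens_l | apply (hc_assoc _ _ _ eq_refl)].
Qed.

(** As [chi_tens] splits [chi] row by row, the braiding passes upwards through [β] and then through
    [α]. *)
Lemma crosses_vcomp C U A D W U' B W'
    (α : cell U A D W) (β : cell U' D B W') :
  crosses C α -> crosses C β -> crosses C (vcomp α β).
Proof.
  intros Hα Hβ.
  trans ((α ⁄ β) ∣ (chi W C ⁄ chi W' C) ⁄ sigma B C).
  { apply vc_cong; [|congr]. apply hc_cong; [apply ceq_refl | apply chi_tens]. }
  trans ((α ∣ chi W C ⁄ (β ∣ chi W' C)) ⁄ sigma B C).
  { apply vc_cong; [apply interchange | congr]. }
  trans (α ∣ chi W C ⁄ (β ∣ chi W' C ⁄ sigma B C)); [apply vc_assoc|].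
  trans (α ∣ chi W C ⁄ (sigma D C ⁄ (chi U' C ∣ β))); [congr|].
  trans (α ∣ chi W C ⁄ sigma D C ⁄ (chi U' C ∣ β)); [apply ceq_sym, vc_assoc|].
  trans (sigma A C ⁄ (chi U C ∣ α) ⁄ (chi U' C ∣ β)); [congr|].
  trans (sigma A C ⁄ ((chi U C ∣ α) ⁄ (chi U' C ∣ β))); [apply vc_assoc|].
  trans (sigma A C ⁄ ((chi U C ⁄ chi U' C) ∣ (α ⁄ β))).
  { apply vc_cong; [congr | apply ceq_sym, interchange]. }
  apply vc_cong; [congr|].
  apply hc_cong; [apply ceq_sym, chi_tens | apply ceq_refl].
Qed.

Lemma sigma_natural_l C A B (f : hom A B) :
  emb f ∣ vid C ⁄ sigma B C ≈ sigma A C ⁄ (vid C ∣ emb f).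
Proof.
  trans (emb f ∣ emb (idm C) ⁄ sigma B C).
  { congr. apply ceq_sym, ceq_emb_id. }
  refine (ceq_trans (sigma_natural _ _) _).
  congr. apply ceq_emb_id.
Qed.

(** * Corner cells *)

Lemma crosses_getL C A : crosses C (getL A).
Proof.
  apply ceq_sym.
  refine (ceq_trans (vc_idl _ _ (sigma_I_l C)) _).
  trans ((getL A ∣ vid C ⁄ sigma A C ⁄ (vid C ∣ putR A)) ∣ (@vid K I ⁄ getL A)).
  { apply hc_cong; [apply chi_Circ | apply ceq_sym, ceq_vidl]. }
  trans ((getL A ∣ vid C ⁄ sigma A C) ∣ @vid K I ⁄ ((vid C ∣ putR A) ∣ getL A)).
  { apply interchange; reflexivity. }
  (* The [putR A] that ends [chi] meets [getL A], so the lower row yanks to an identity; the upper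
     row is the other side, as [chi [] C] is [vid C]. *)
  refine (ceq_trans (vc_idr (X := C ⊗ A) _ _ _) (hc_idr _ _ vid_I)).
  trans (vid C ∣ (putR A ∣ getL A)); [apply hc_assoc; reflexivity|].
  trans (vid C ∣ vid A); [|apply ceq_sym, ceq_vid_tens].
  apply hc_cong; [congr | apply ceq_putR_getL].
Qed.

Lemma crosses_putR C A : crosses C (putR A).
Proof.
  refine (ceq_trans (vc_idr _ _ (sigma_I_l C)) _).
  trans ((putR A ⁄ @vid K I) ∣ (getL A ∣ vid C ⁄ (sigma A C ⁄ (vid C ∣ putR A)))).
  { apply hc_cong; [apply ceq_sym, ceq_vidr|].
    exact (ceq_trans (chi_Circ _ _) (ceq_vcompA _ _ _)). }
  trans ((putR A ∣ (getL A ∣ vid C)) ⁄ (@vid K I ∣ (sigma A C ⁄ (vid C ∣ putR A)))).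
  { apply interchange; reflexivity. }
  refine (ceq_trans (vc_idl (X := A ⊗ C) _ _ _) (hc_idl _ _ vid_I)).
  trans (putR A ∣ getL A ∣ vid C); [apply ceq_sym, hc_assoc; reflexivity|].
  trans (vid A ∣ vid C); [|apply ceq_sym, ceq_vid_tens].
  apply hc_cong; [apply ceq_putR_getL | congr].
Qed.

(** The crossing cell of [Bullet A] braids [C] past [A], so yanking leaves [sigma C A] next to
    [sigma A C]; these cancel by symmetry. The same happens in [crosses_putL]. *)
Lemma crosses_getR C A : crosses C (getR A).
Proof.
  trans ((vid C ∣ getR A) ⁄ sigma C A ⁄ sigma A C).
  { apply vc_cong; [|congr].
    trans ((@vid K I ⁄ getR A) ∣ ((vid C ∣ getR A) ⁄ sigma C A ⁄ (putL A ∣ vid C))).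
    { apply hc_cong; [apply ceq_sym, ceq_vidl | apply chi_Bullet]. }
    trans (@vid K I ∣ ((vid C ∣ getR A) ⁄ sigma C A) ⁄ (getR A ∣ (putL A ∣ vid C))).
    { apply interchange; reflexivity. }
    refine (ceq_trans (vc_idr (X := A ⊗ C) _ _ _) (hc_idl _ _ vid_I)).
    trans (getR A ∣ putL A ∣ vid C); [apply ceq_sym, hc_assoc; reflexivity|].
    trans (vid A ∣ vid C); [|apply ceq_sym, ceq_vid_tens].
    apply hc_cong; [apply ceq_getR_putL | congr]. }
  trans ((vid C ∣ getR A) ⁄ (sigma C A ⁄ sigma A C)); [apply vc_assoc|].
  refine (ceq_trans (vc_idr _ _ (sigma_sym _)) _).
  apply ceq_sym, (vc_idl _ _ (sigma_I_l C)).
Qed.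

Lemma crosses_putL C A : crosses C (putL A).
Proof.
  refine (ceq_trans (vc_idr _ _ (sigma_I_l C)) _). apply ceq_sym.
  trans (sigma A C ⁄ (sigma C A ⁄ (putL A ∣ vid C))).
  { apply vc_cong; [congr|].
    trans (((vid C ∣ getR A) ⁄ (sigma C A ⁄ (putL A ∣ vid C))) ∣ (putL A ⁄ @vid K I)).
    { apply hc_cong; [|apply ceq_sym, ceq_vidr].
      exact (ceq_trans (chi_Bullet _ _) (ceq_vcompA _ _ _)). }
    trans (((vid C ∣ getR A) ∣ putL A) ⁄ ((sigma C A ⁄ (putL A ∣ vid C)) ∣ @vid K I)).
    { apply interchange; reflexivity. }
    refine (ceq_trans (vc_idl (X := C ⊗ A) _ _ _) (hc_idr _ _ vid_I)).
    trans (vid C ∣ (getR A ∣ putL A)); [apply hc_assoc; reflexivity|].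
    trans (vid C ∣ vid A); [|apply ceq_sym, ceq_vid_tens].
    apply hc_cong; [congr | apply ceq_getR_putL]. }
  trans (sigma A C ⁄ sigma C A ⁄ (putL A ∣ vid C)); [apply ceq_sym, vc_assoc|].
  apply (vc_idl _ _ (sigma_sym _)).
Qed.

(** * Choice cells: products, sums and copairings *)

Lemma chi_pi0 C U W : pi0 U W ∣ chi U C ≈ chi [Times U W] C ∣ pi0 U W.
Proof.
  apply ceq_sym. refine (ceq_trans _ (ceq_times_pi0 _ _)).
  apply (hc_cong _ eq_refl); [apply chi_Times | congr].
Qed.

Lemma chi_pi1 C U W : pi1 U W ∣ chi W C ≈ chi [Times U W] C ∣ pi1 U W.
Proof.
  apply ceq_sym. refine (ceq_trans _ (ceq_times_pi1 _ _)).
  apply (hc_cong _ eq_refl); [apply chi_Times | congr].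
Qed.

Lemma chi_iota0 C U W : iota0 U W ∣ chi [Plus U W] C ≈ chi U C ∣ iota0 U W.
Proof.
  refine (ceq_trans _ (ceq_iota0_plus _ _)).
  apply (hc_cong _ eq_refl); [congr | apply chi_Plus].
Qed.

Lemma chi_iota1 C U W : iota1 U W ∣ chi [Plus U W] C ≈ chi W C ∣ iota1 U W.
Proof.
  refine (ceq_trans _ (ceq_iota1_plus _ _)).
  apply (hc_cong _ eq_refl); [congr | apply chi_Plus].
Qed.

(** Meant for a pairing [τ] and a projection [ρ]: on both sides [ρ] slides into the row of [τ],
    passing [chi] where necessary, and selects the component [α], whose crossing is known. *)
Lemma crosses_hc_r C V A B X Y (τ : cell V A B X) (ρ : cell X I I Y)
    (α : cell V A B Y) :
  ρ ∣ chi Y C ≈ chi X C ∣ ρ -> τ ∣ ρ ≈ α -> crosses C α ->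
  (τ ∣ chi X C ⁄ sigma B C) ∣ ρ ≈ (sigma A C ⁄ (chi V C ∣ τ)) ∣ ρ.
Proof.
  intros Hρ Hτ Hα.
  trans ((τ ∣ chi X C ∣ ρ) ⁄ sigma B C); [apply hc_vc_upper_r|].
  trans (α ∣ chi Y C ⁄ sigma B C).
  { apply vc_cong; [|congr].
    trans (τ ∣ (chi X C ∣ ρ)); [apply hc_assoc|].
    trans (τ ∣ (ρ ∣ chi Y C)); [congr|].
    trans (τ ∣ ρ ∣ chi Y C); [apply ceq_sym, hc_assoc | congr]. }
  refine (ceq_trans Hα _). apply ceq_sym.
  trans (sigma A C ⁄ (chi V C ∣ τ ∣ ρ)); [apply hc_vc_lower_r|].
  apply vc_cong; [congr|].
  trans (chi V C ∣ (τ ∣ ρ)); [apply hc_assoc | congr].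
Qed.

(** Mirror image, for [τ] built by [plus] and [ρ] an injection acting from the left. *)
Lemma crosses_hc_l C V A B X Y (τ : cell X A B V) (ρ : cell Y I I X)
    (α : cell Y A B V) :
  ρ ∣ chi X C ≈ chi Y C ∣ ρ -> ρ ∣ τ ≈ α -> crosses C α ->
  ρ ∣ (τ ∣ chi V C ⁄ sigma B C) ≈ ρ ∣ (sigma A C ⁄ (chi X C ∣ τ)).
Proof.
  intros Hρ Hτ Hα.
  trans (ρ ∣ (τ ∣ chi V C) ⁄ sigma B C); [apply hc_vc_upper_l|].
  trans (α ∣ chi V C ⁄ sigma B C).
  { apply vc_cong; [|congr].
    trans (ρ ∣ τ ∣ chi V C); [apply ceq_sym, hc_assoc | congr]. }
  refine (ceq_trans Hα _). apply ceq_sym.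
  trans (sigma A C ⁄ (ρ ∣ (chi X C ∣ τ))); [apply hc_vc_lower_l|].
  apply vc_cong; [congr|].
  trans (ρ ∣ chi X C ∣ τ); [apply ceq_sym, hc_assoc|].
  trans (chi Y C ∣ ρ ∣ τ); [congr|].
  trans (chi Y C ∣ (ρ ∣ τ)); [apply hc_assoc | congr].
Qed.

Lemma crosses_times C V A B U W (α : cell V A B U) (β : cell V A B W) :
  crosses C α -> crosses C β -> crosses C (times α β).
Proof.
  intros Hα Hβ. unfold crosses.
  unshelve eapply (times_ext (U := U) (W := W)); [solve_boundary .. | |].
  - refine (ceq_trans _ (ceq_trans (crosses_hc_r (chi_pi0 _ _ _) _ Hα) _)); [congr| |congr].
    apply ceq_times_pi0.
  - refine (ceq_trans _ (ceq_trans (crosses_hc_r (chi_pi1 _ _ _) _ Hβ) _)); [congr| |congr].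
    apply ceq_times_pi1.
Qed.

Lemma crosses_plus C U A B V W (α : cell U A B V) (β : cell W A B V) :
  crosses C α -> crosses C β -> crosses C (plus α β).
Proof.
  intros Hα Hβ. unfold crosses.
  unshelve eapply (plus_ext (U := U) (W := W)); [solve_boundary .. | |].
  - refine (ceq_trans _ (ceq_trans (crosses_hc_l (chi_iota0 _ _ _) _ Hα) _)); [congr| |congr].
    apply ceq_iota0_plus.
  - refine (ceq_trans _ (ceq_trans (crosses_hc_l (chi_iota1 _ _ _) _ Hβ) _)); [congr| |congr].
    apply ceq_iota1_plus.
Qed.

(** Naturality carries [emb f] below the braiding, where it meets [γ]. For [f] an injection and [γ]
    a copairing this is one of the two checks required by [copair_tens_ext]. *)
Lemma crosses_precomp C U A A' B W (f : hom A A') (γ : cell U A' B W)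
    (α : cell U A B W) :
  emb f ⁄ γ ≈ α -> crosses C α ->
  emb f ∣ vid C ⁄ (γ ∣ chi W C ⁄ sigma B C)
  ≈ emb f ∣ vid C ⁄ (sigma A' C ⁄ (chi U C ∣ γ)).
Proof.
  intros Hγ Hα.
  trans (emb f ∣ vid C ⁄ (γ ∣ chi W C) ⁄ sigma B C); [apply ceq_sym, vc_assoc|].
  trans (α ∣ chi W C ⁄ sigma B C).
  { apply vc_cong; [|congr].
    trans ((emb f ⁄ γ) ∣ (vid C ⁄ chi W C)); [apply ceq_sym, interchange|].
    congr. apply ceq_vidl. }
  refine (ceq_trans Hα _). apply ceq_sym.
  trans (emb f ∣ vid C ⁄ sigma A' C ⁄ (chi U C ∣ γ)); [apply ceq_sym, vc_assoc|].
  trans (sigma A C ⁄ (vid C ∣ emb f) ⁄ (chi U C ∣ γ)).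
  { apply vc_cong; [apply sigma_natural_l | congr]. }
  trans (sigma A C ⁄ ((vid C ∣ emb f) ⁄ (chi U C ∣ γ))); [apply vc_assoc|].
  apply vc_cong; [congr|].
  trans ((vid C ⁄ chi U C) ∣ (emb f ⁄ γ)); [apply ceq_sym, interchange|].
  congr. apply ceq_vidl.
Qed.

Lemma crosses_copair C U A B D W (α : cell U A D W) (β : cell U B D W) :
  crosses C α -> crosses C β -> crosses C (copair α β).
Proof.
  intros Hα Hβ. unfold crosses.
  eapply copair_tens_ext; [solve_boundary .. | |].
  - refine (ceq_trans _ (ceq_trans (crosses_precomp (f := inj0 A B) _ Hα) _)); [congr| |congr].
    apply ceq_inj0_copair.
  - refine (ceq_trans _ (ceq_trans (crosses_precomp (f := inj1 A B) _ Hβ) _)); [congr| |congr].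
    apply ceq_inj1_copair.
Qed.

Lemma all_cells_cross C U A B W (α : cell U A B W) : crosses C α.
Proof.
  induction α.
  - apply crosses_hid.
  - apply crosses_vid.
  - apply crosses_hcomp; assumption.
  - apply crosses_vcomp; assumption.
  (* Both side boundaries are [[]] and [chi [] C] computes to [vid C], so the goal is naturality
     against the identity of [C]. *)
  - apply sigma_natural_l.
  - apply crosses_getL.
  - apply crosses_putR.
  - apply crosses_getR.
  - apply crosses_putL.
  - apply crosses_I, chi_pi0.
  - apply crosses_I, chi_pi1.
  - apply crosses_times; assumption.
  - apply crosses_I, chi_iota0.
  - apply crosses_I, chi_iota1.
  - apply crosses_plus; assumption.
  - apply crosses_copair; assumption.
Qed.

End Crossing.

Theorem lemma12 (K : DistributiveMonoidalCategory)
    (U W : exchange K) (A B C : K) (α : cell U A B W) :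
  (recast (app_nil_r U) eq_refl eq_refl (app_nil_r W)
     (vcomp (hcomp α (chi W C)) (sigma B C))
   : cell U (A ⊗ C) (C ⊗ B) W)
  ≈ (vcomp (sigma A C) (hcomp (chi U C) α)
     : cell U (A ⊗ C) (C ⊗ B) W).
Proof.
  (* Once the recasting is removed, the equation is convertible to [crosses C α], whose boundary
     proofs are all [eq_refl]. *)
  exact (ceq_trans (ceq_recast _ _ _ _ _) (all_cells_cross C α)).
Qed.
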